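(* Let $n\ge1$. The Haglund–Loehr zeta map of type $C_n$, $\zeta_C:\operatorname{Vert}(C_n)\to\operatorname{Diag}(C_n)$, $(\pi,u)\mapsto(\zeta_C(\pi),d_C(\pi,u))$, is a well-defined bijection.
   Context: Paths: $\mathcal L_{a,b}$ is the set of words in $\{N,E\}$ with $a$ letters $E$ and $b$ letters $N$; $\mathcal B_m$ is the set of words of length $m$ in $\{N,E\}$ all of whose prefixes have at least as many $N$'s as $E$'s. For a path, $i$ is a rise if its $i$-th $N$ is immediately followed by an $N$; $(i,j)$ is a valley if its $i$-th $E$ is immediately followed by its $j$-th $N$; moreover, if a ballot path with $i$ East steps and $j$ North steps ends with an East step, then $(i,j+1)$ also counts as a valley. For an integer vector $a=(a_1,\dots,a_n)$ and $j\ge0$: $\overrightarrow{S}^+_j(a)$ reads $a$ left to right writing $N$ for each entry $j$ and $E$ for each entry $j+1$; $\overleftarrow{S}^+_j(a)$ does the same reading right to left; $\overrightarrow{S}^-_j(a)$, $\overleftarrow{S}^-_j(a)$ do the same with $N$ for entries $-j$ and $E$ for entries $-j-1$. $\mathfrak S_n^C$ is the group of signed permutations, i.e. bijections $u$ of $\{\pm1,\dots,\pm n\}$ with $u(-i)=-u(i)$, written $[u(1),\dots,u(n)]$. For $\pi\in\mathcal L_{n,n}$ let $\lambda_i$ be the number of East steps before the $i$-th North step, and let $\mu_i=(n+1-i)-\lambda_{n+1-i}$ (type $C_n$ area vector). $\zeta_C(\pi)=\overleftarrow{S}^-_n(\mu)\overrightarrow{S}^+_n(\mu)\cdots\overleftarrow{S}^-_0(\mu)\overrightarrow{S}^+_0(\mu)\in\mathcal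 B_{2n}$. $\operatorname{Vert}(C_n)$ is the set of pairs $(\pi,u)$ with $\pi\in\mathcal L_{n,n}$, $u\in\mathfrak S_n^C$, such that $u(i)<u(i+1)$ for every rise $i$ of $\pi$, and $u(1)>0$ if $\pi$ begins with a North step. The diagonal reading word $d_C(\pi,u)\in\mathfrak S_n^C$ is the window obtained as follows: for $i=0,1,\dots,n$ in turn, first write down $-u(j)$ for all $j$ with $\mu_{n+1-j}=-i$, in order of decreasing $j$, then write down $u(j)$ for all $j$ with $\mu_{n+1-j}=i+1$, in order of increasing $j$. $\operatorname{Diag}(C_n)$ is the set of pairs $(\beta,w)$ with $\beta\in\mathcal B_{2n}$, $w\in\mathfrak S_n^C$, such that for every valley $(i,j)$ of $\beta$ we have $w(n+1-i)>w(n+1-j)$ if $j\le n$ and $w(n+1-i)>w(n-j)$ if $j>n$ (where $w(-k)=-w(k)$). *)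

(* Defs.v *)
From HB Require Import structures.
From mathcomp Require Import all_boot all_order all_algebra all_fingroup.
Set Implicit Arguments.
Unset Strict Implicit.
Unset Printing Implicit Defensive.
Import Order.TTheory GRing.Theory Num.Theory.
Local Open Scope ring_scope.

Inductive step := North | East.

Definition is_north (s : step) : bool := if s is North then true else false.

Lemma is_northK : cancel is_north (fun b : bool => if b then North else East).
Proof. by case. Qed.

HB.instance Definition _ := Finite.copy step (can_type is_northK).

Definition lattice_path (a b : nat) : Type :=
  {w : (a + b).-tuple step |
    (count_mem East w == a) && (count_mem North w == b)}.

Definition path_word (a b : nat) (p : lattice_path a b) : seq step := val p.
Coercion path_word : lattice_path >-> list.

Definition ballot_word (w : seq step) : bool :=
  [forall k : 'I_(size w).+1,
    (count_mem East (take k w) <= count_mem North (take k w))%N].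

Definition ballot_path (m : nat) : Type :=
  {w : m.-tuple step | ballot_word w}.

Definition ballot_path_word (m : nat) (p : ballot_path m) : seq step := val p.
Coercion ballot_path_word : ballot_path >-> list.

(* Rises and valleys are numbered from 1: counting the North (East) steps up to
   and including position k gives the number of the step at position k. *)
Definition rise (w : seq step) (i : nat) : bool :=
  [exists k : 'I_(size w),
    [&& onth w k == Some North, onth w k.+1 == Some North
      & count_mem North (take k.+1 w) == i]].

Definition valley (w : seq step) (i j : nat) : bool :=
  [exists k : 'I_(size w),
    [&& onth w k == Some East, onth w k.+1 == Some North,
        count_mem East (take k.+1 w) == i
      & count_mem North (take k.+2 w) == j]].

Definition ballot_valley (w : seq step) (i j : nat) : bool :=
  valley w i j
  || [&& last North w == East, count_mem East w == i
       & (count_mem North w).+1 == j].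

Definition pm_seq (n : nat) : seq int :=
  [seq k%:Z | k <- iota 1 n] ++ [seq - k%:Z | k <- iota 1 n].

(* The set {1, ..., n, -1, ..., -n}, as a finite subtype of int. *)
Definition pm (n : nat) : Type := seq_sub (pm_seq n).

(* Value at an arbitrary integer, with the junk value 0 outside
   {1, ..., n, -1, ..., -n}. *)
Definition perm_at (n : nat) (u : {perm pm n}) (k : int) : int :=
  if (insub k : option (pm n)) is Some x then val (u x) else 0.

Definition signed_perm (n : nat) : Type :=
  {u : {perm pm n} |
    [forall k : pm n, perm_at u (- val k) == - perm_at u (val k)]}.

Definition signed_perm_fun (n : nat) (u : signed_perm n) : int -> int :=
  perm_at (val u).
Coercion signed_perm_fun : signed_perm >-> Funclass.

Definition window (n : nat) (u : signed_perm n) : seq int :=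
  [seq u k%:Z | k <- iota 1 n].

(* S_reading a b v writes N for each entry a and E for each entry b. *)
Definition S_reading (a b : int) (v : seq int) : seq step :=
  pmap (fun x => if x == a then Some North
                 else if x == b then Some East else None) v.

Definition S_plus_right (j : nat) (v : seq int) : seq step :=
  S_reading j%:Z (j%:Z + 1) v.
Definition S_minus_left (j : nat) (v : seq int) : seq step :=
  S_reading (- j%:Z) (- j%:Z - 1) (rev v).

(* The sequence (lambda_1, lambda_2, ...): k runs over the positions of the
   North steps. *)
Definition lambda_seq (w : seq step) : seq nat :=
  [seq count_mem East (take k w) | k <- iota 0 (size w) & nth East w k == North].

Definition lambda (w : seq step) (i : nat) : nat := nth 0%N (lambda_seq w) i.-1.

Definition mu (n : nat) (p : lattice_path n n) (i : nat) : int :=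
  (n.+1 - i)%N%:Z - (lambda p (n.+1 - i)%N)%:Z.

Definition area_vector (n : nat) (p : lattice_path n n) : seq int :=
  [seq mu p i | i <- iota 1 n].

Definition zetaC (n : nat) (p : lattice_path n n) : seq step :=
  flatten [seq S_minus_left j (area_vector p) ++ S_plus_right j (area_vector p)
          | j <- rev (iota 0 n.+1)].

Definition dC (n : nat) (p : lattice_path n n) (u : signed_perm n) : seq int :=
  flatten [seq
    [seq - u j%:Z | j <- rev (iota 1 n) & mu p (n.+1 - j)%N == - i%:Z]
    ++ [seq u j%:Z | j <- iota 1 n & mu p (n.+1 - j)%N == i%:Z + 1]
    | i <- iota 0 n.+1].

Definition vert_cond (n : nat) (p : lattice_path n n) (u : signed_perm n) : bool :=
  [forall i : 'I_(size p).+1, rise p i ==> (u i%:Z < u i.+1%:Z)]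
  && ((head East p == North) ==> (0 < u 1)).

Definition Vert (n : nat) : Type :=
  {x : lattice_path n n * signed_perm n | vert_cond x.1 x.2}.

Definition vert_path (n : nat) (x : Vert n) : lattice_path n n := (val x).1.
Definition vert_perm (n : nat) (x : Vert n) : signed_perm n := (val x).2.

(* The index n - j is negative when j > n. *)
Definition diag_cond (n : nat) (b : ballot_path (2 * n)) (w : signed_perm n) : bool :=
  [forall i : 'I_(size b).+1, forall j : 'I_(size b).+2,
    ballot_valley b i j ==>
      (if (j <= n)%N then w (n.+1%:Z - j%:Z) < w (n.+1%:Z - i%:Z)
       else w (n%:Z - j%:Z) < w (n.+1%:Z - i%:Z))].

Definition Diag (n : nat) : Type :=
  {x : ballot_path (2 * n) * signed_perm n | diag_cond x.1 x.2}.

Definition diag_path (n : nat) (y : Diag n) : ballot_path (2 * n) := (val y).1.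
Definition diag_perm (n : nat) (y : Diag n) : signed_perm n := (val y).2.

(* A signed permutation is determined by its window. *)
Lemma window_inj (n : nat) : injective (@window n).
Proof.
move=> u w euw; have pos k : (0 < k <= n)%N -> u k%:Z = w k%:Z.
  move=> kn; have ki : k \in iota 1 n by rewrite mem_iota add1n ltnS.
  exact: (eq_in_map _ _ _).2 euw k ki.
have all_eq (x : pm n) : u (val x) = w (val x).
  have /= := valP x; rewrite mem_cat => /orP[] /mapP[k ki xk].
    by rewrite xk; apply: pos; move: ki; rewrite mem_iota add1n ltnS.
  have kx : k%:Z \in pm_seq n by rewrite mem_cat map_f.
  have odd (v : signed_perm n) : v (val x) = - v k%:Z.
    by have /forallP/(_ (SeqSub kx))/eqP := valP v; rewrite -xk.
  by rewrite !odd pos //; move: ki; rewrite mem_iota add1n ltnS.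
apply: val_inj; apply/permP => x; apply: val_inj.
by have := all_eq x; rewrite /signed_perm_fun /perm_at valK.
Qed.

(* Main.v *)
Require Import Defs.
From mathcomp Require Import all_boot all_order all_algebra all_fingroup.
From mathcomp Require Import zify.

(** Put [A j = j - lambda_j] for [1 <= j <= n] and [A (-j) = - A j], [A 0 = 0].
In the cyclic order [-1, ..., -n, n, ..., 1, 0] of the positions, [A] drops by
at most 1 at each step. The word [zeta_C(pi) N] is the concatenation, for
[k = n, ..., 0], of the readings of this cycle with a North step for each
value [k] and an East step for each value [k + 1].  Remembering the positions:

- a reading of level [k >= 0] ends with a North step, and a valley of
  [zeta_C(pi) N] pairs an East step at [x] with a North step at [y] exactly
  when [x, y] are adjacent in the cycle and [A x = A y + 1]: valleys correspond
  to rises of [pi] (and to its initial North step), and counting steps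
  identifies the labels of the two, so the two labelling conditions agree;

- the word determines its levels, because the number of North steps of the
  lowest level is the excess of North over East steps, and the preceding level
  ends with a North step; the levels determine [A], because [A] drops by at
  most 1.  Hence [zeta_C] is injective on paths, and it is bijective since
  lattice paths and ballot paths are equinumerous by the reflection principle;

- [d_C(pi, -)] reads [u] along a fixed signed permutation of the positions, so
  it is a bijection of the signed permutations. *)

Set Implicit Arguments.
Unset Strict Implicit.
Unset Printing Implicit Defensive.
Import Order.TTheory GRing.Theory Num.Theory.
Local Open Scope ring_scope.

Local Arguments infix : simpl never.

(** * Pairs of adjacent entries of a sequence *)

Section Infix2.
Variable T : eqType.
Implicit Types (x y a b : T) (s t : seq T).

Lemma infix2_cons x y a s :
  infix [:: x; y] (a :: s) = (x == a) && (ohead s == Some y) || infix [:: x; y] s.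
Proof.
case: s => [|b s]; rewrite {1}/infix /= ?prefix0s ?andbT ?andbF //.
by rewrite [x == a]eq_sym [y == b]eq_sym.
Qed.

Lemma infix2_cat x y s a t :
  infix [:: x; y] (rcons s a ++ t)
  = [|| infix [:: x; y] (rcons s a), (x == a) && (ohead t == Some y) | infix [:: x; y] t].
Proof.
elim: s => [|c s IH]; first by rewrite /= !infix2_cons /= andbF.
by rewrite /= !infix2_cons IH orbA; case: s {IH}.
Qed.

Lemma infix2_iota (g : nat -> T) x y m n :
  reflect (exists2 k, (m <= k)%N && (k.+1 < m + n)%N & x = g k /\ y = g k.+1)
          (infix [:: x; y] [seq g k | k <- iota m n]).
Proof.
elim: n m x y => [|n IH] m x y; first by right=> -[k]; lia.
rewrite /= infix2_cons; apply: (iffP orP) => [[/andP[/eqP -> ]|/IH[k kn xy]]|[k kn [-> ->]]].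
- by case: n {IH} => //= n /eqP[<-]; exists m => //; lia.
- by exists k => //; lia.
have [->|km] := eqVneq k m.
  by left; rewrite eqxx; case: n {IH} kn => [|n] /=; [lia|rewrite eqxx].
by right; apply/IH; exists k => //; lia.
Qed.

Lemma infix2_sorted (r : rel T) s :
  (forall x y, infix [:: x; y] s -> r x y) -> sorted r s.
Proof.
elim: s => //= a [|b s] //= IH rP; rewrite rP ?IH //.
  by move=> x y xy; apply: rP; rewrite infix2_cons xy orbT.
by rewrite infix2_cons /= !eqxx.
Qed.

End Infix2.

(** * Labelled readings of a sequence at one level and at consecutive levels *)

Section Reading.
Variables (T : eqType) (f : T -> int).
Implicit Types (k : int) (x p q : T) (s : seq T).

(** Each step keeps the entry that produced it, so that valleys of the word can be traced back to
    positions; [reading_steps] forgets these labels. *)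
Definition reading k s : seq (step * T) :=
  pmap (fun x => if f x == k then Some (North, x)
                 else if f x == k + 1 then Some (East, x) else None) s.

Local Arguments reading : simpl never.

Lemma reading_cons k x s :
  reading k (x :: s) = if f x == k then (North, x) :: reading k s
                       else if f x == k + 1 then (East, x) :: reading k s
                       else reading k s.
Proof. by rewrite /reading /=; case: ifP => //; case: ifP. Qed.

Lemma reading_rcons k s x :
  reading k (rcons s x) = reading k s ++ reading k [:: x].
Proof. by rewrite -cats1 /reading pmap_cat. Qed.

Lemma reading_steps k s : map fst (reading k s) = S_reading k (k + 1) (map f s).
Proof.
elim: s => //= x s IH; rewrite reading_cons -IH.
by case: ifP => //; case: ifP.
Qed.

Definition labels (d : step) (z : seq (step * T)) : seq T :=
  [seq c.2 | c <- z & c.1 == d].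

Lemma labels_cat d z1 z2 : labels d (z1 ++ z2) = labels d z1 ++ labels d z2.
Proof. by rewrite /labels filter_cat map_cat. Qed.

Lemma labels_flatten d (zs : seq (seq (step * T))) :
  labels d (flatten zs) = flatten (map (labels d) zs).
Proof. by elim: zs => //= z zs IH; rewrite labels_cat IH. Qed.

Lemma size_labels d z : size (labels d z) = count_mem d (map fst z).
Proof. by rewrite size_map size_filter count_map; apply: eq_count. Qed.

Lemma labels_north k s : labels North (reading k s) = [seq x <- s | f x == k].
Proof.
rewrite /labels; elim: s => //= x s IH; rewrite reading_cons.
by case: eqP => //= _; rewrite ?IH //; case: ifP.
Qed.

Lemma labels_east k s : labels East (reading k s) = [seq x <- s | f x == k + 1].
Proof.
rewrite /labels; elim: s => //= x s IH; rewrite reading_cons.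
have [->|_] := eqVneq (f x) k; first by rewrite -IH /= lt_eqF //; lia.
by case: ifP => //= _; rewrite IH.
Qed.

Definition drop_at_most1 : rel T := fun x y => f x <= f y + 1.

(** As values drop by at most 1, a sequence coming from above [k + 1] meets [k + 1], an East step,
    before it can meet [k]. *)
Lemma reading_high k x q s :
  path drop_at_most1 x s -> k + 1 < f x -> ohead (reading k s) != Some (North, q).
Proof.
elim: s x => //= y s IH x /andP[xy ys] kx; rewrite reading_cons.
rewrite /drop_at_most1 in xy.
case: (eqVneq (f y) k) => [yk|_]; first by exfalso; lia.
by case: (eqVneq (f y) (k + 1)) => // yk; apply: (IH y) => //; lia.
Qed.

(** The value after [x] is at least [k]. If it is not [k], it is either [k + 1], an East step, or
    larger, and then [reading_high] applies. *)
Lemma reading_next k x q s :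
  path drop_at_most1 x s -> f x = k + 1 ->
  (ohead (reading k s) == Some (North, q)) = (ohead s == Some q) && (f q == k).
Proof.
case: s => //= y s /andP[xy ys] fx; rewrite reading_cons.
rewrite /drop_at_most1 in xy.
have eS (U : eqType) (b c : U) : (Some b == Some c) = (b == c) by [].
rewrite [Some y == _]eS; case: (eqVneq (f y) k) => [yk|yk] /=.
  rewrite eS xpair_eqE eqxx /=; case: (eqVneq y q) => [<-|//] /=; exact/esym/eqP.
case: (eqVneq (f y) (k + 1)) => [yk1|yk1] /=.
  by case: (eqVneq y q) => [<-|//]; rewrite /= (negPf yk).
rewrite (negPf (reading_high _ ys _)); last by lia.
by case: (eqVneq y q) => [<-|//]; rewrite (negPf yk).
Qed.

Lemma reading_infix k p q s :
  sorted drop_at_most1 s ->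
  infix [:: (East, p); (North, q)] (reading k s)
  = [&& infix [:: p; q] s, f p == k + 1 & f q == k].
Proof.
elim: s => //= x s IH xs; rewrite reading_cons infix2_cons.
have {}IH := IH (path_sorted xs).
case: (eqVneq (f x) k) => [xk|xk].
  rewrite infix2_cons /= IH; case: (eqVneq p x) => [->|//] /=.
  by rewrite xk (_ : k == k + 1 = false) ?andbF //; lia.
case: (eqVneq (f x) (k + 1)) => [xk1|xk1].
  rewrite infix2_cons IH xpair_eqE eqxx /= (reading_next _ xs xk1) andb_orl.
  by case: (eqVneq p x) => [->|//]; rewrite xk1 eqxx.
by rewrite IH; case: (eqVneq p x) => [->|//]; rewrite (negPf xk1) !andbF.
Qed.

(* Once above level k, the values return to at most k only through k itself. *)
Lemma reading_last_path k x s :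
  path drop_at_most1 x s -> f (last x s) <= k ->
  last (if f x <= k then North else East) (map fst (reading k s)) = North.
Proof.
elim: s x => [|y s IH] x /=; first by move=> _ ->.
rewrite /drop_at_most1 => /andP[xy ys] /(IH _ ys){IH}; rewrite reading_cons.
case: eqP => [->|yk] /=; first by rewrite lexx.
case: eqP => [->|yk1] /=; first by rewrite (_ : k + 1 <= k = false) //; lia.
case: (lerP (f y) k) => [ylek|kley]; case: (lerP (f x) k) => [xlek|klex] //.
  by lia.
by case: (reading k s).
Qed.

(** The default [North] of [last] lets an empty reading count as one ending with a North step, so
    that the property passes to concatenations of levels. *)
Lemma reading_last k s x :
  sorted drop_at_most1 (rcons s x) -> f x <= k ->
  last North (map fst (reading k (rcons s x))) = North.
Proof.
case: s => [|y s] /= yx xk.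
  by rewrite reading_cons /=; case: eqP => //= xk'; case: eqP => //=; lia.
have := reading_last_path yx; rewrite last_rcons => /(_ _ xk); rewrite reading_cons.
case: eqP => [->|_] /=; first by rewrite lexx.
case: eqP => [->|_] /=; first by rewrite (_ : k + 1 <= k = false) //; lia.
by case: ifP => // _; case: (reading k _).
Qed.

Definition levels (k m : nat) s : seq (step * T) :=
  flatten [seq reading i%:Z s | i <- rev (iota k m)].

Lemma levelsS (k m : nat) s : levels k m.+1 s = levels k.+1 m s ++ reading k s.
Proof. by rewrite /levels /= rev_cons map_rcons flatten_rcons. Qed.

(** An entry of value [i > k] gives a North step at level [i] and an East step at level [i - 1]; an
    entry of value [k] gives a North step alone. The bound on [f] excludes entries read only as East
    steps of the top level. *)
Lemma levels_count (k m : nat) s :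
  (forall x, x \in s -> f x < (k + m)%:Z) ->
  count_mem North (map fst (levels k m s))
  = (count_mem East (map fst (levels k m s)) + count (fun x => f x == k) s)%N.
Proof.
elim: m k => [|m IH] k sk.
  rewrite /levels /= -[LHS](count_pred0 s); apply: eq_in_count => x /sk /= xs.
  by apply/esym/eqP; lia.
rewrite levelsS !map_cat !count_cat {}IH; last by move=> x /sk; lia.
rewrite -!size_labels labels_north labels_east !size_filter.
rewrite (_ : k.+1%:Z = k%:Z + 1); last by lia.
by [].
Qed.

(** Before level [k], North exceeds East by the number of entries of value [k + 1] ([levels_count]),
    and these are all the East steps of level [k]. *)
Lemma levels_ballot (k m : nat) s t :
  (forall x, x \in s -> f x < (k + m)%:Z) ->
  (count_mem East (take t (map fst (levels k m s)))
   <= count_mem North (take t (map fst (levels k m s))))%N.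
Proof.
elim: m k t => [|m IH] k t sk; first by rewrite /levels.
have sk1 x : x \in s -> f x < (k.+1 + m)%:Z by move=> /sk; lia.
rewrite levelsS map_cat take_cat; case: ltnP => _; first exact: IH.
rewrite !count_cat (levels_count sk1).
set r := map fst (reading k s); set t' := (t - _)%N.
have : (count_mem East (take t' r) <= count_mem East r)%N.
  by rewrite -[in X in (_ <= X)%N](cat_take_drop t' r) count_cat leq_addr.
rewrite -[X in (_ <= X)%N -> _]size_labels labels_east size_filter.
by rewrite (_ : k.+1%:Z = k%:Z + 1); lia.
Qed.

Lemma levels_last (k m : nat) s x :
  sorted drop_at_most1 (rcons s x) -> f x <= k%:Z ->
  last North (map fst (levels k m (rcons s x))) = North.
Proof.
move=> sx; elim: m k => [|m IH] k xk; first by rewrite /levels.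
by rewrite levelsS map_cat last_cat IH ?reading_last //; lia.
Qed.

(** What precedes a level is empty or ends with a North step, so no pair East, North straddles two
    levels; inside one level [reading_infix] applies. *)
Lemma levels_infix (k m : nat) p q s x :
  sorted drop_at_most1 (rcons s x) -> f x <= k%:Z ->
  infix [:: (East, p); (North, q)] (levels k m (rcons s x))
  = [&& infix [:: p; q] (rcons s x), f p == f q + 1 & k%:Z <= f q < (k + m)%:Z].
Proof.
move=> sx; elim: m k => [|m IH] k xk.
  by rewrite /levels /= infixs0 addn0; apply/esym/negbTE; lia.
have xk1 : f x <= k.+1%:Z by lia.
have := levels_last m sx xk1; rewrite levelsS.
move: {IH}(IH _ xk1); case: (lastP (levels k.+1 m _)) => [|r [d y]] IH.
  move=> _; rewrite reading_infix //; move: (esym IH); rewrite infixs0 /=.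
  by case: infix => //=; rewrite (_ : (_ == [::]) = false) //; lia.
rewrite map_rcons last_rcons /= => dN; rewrite {d}dN in IH *.
rewrite infix2_cat xpair_eqE /= reading_infix // IH.
by case: infix => //=; lia.
Qed.

End Reading.

Local Arguments reading : simpl never.
Local Arguments S_reading : simpl never.
Local Arguments lambda_seq : simpl never.

(** * Recovering the levels from the word, and a sequence from its levels *)

Lemma S_reading_cons a b x v :
  S_reading a b (x :: v) = if x == a then North :: S_reading a b v
                           else if x == b then East :: S_reading a b v
                           else S_reading a b v.
Proof. by rewrite /S_reading /=; case: ifP => //; case: ifP. Qed.

Lemma S_reading_above x y s :
  path (drop_at_most1 id) x s -> y < x ->
  ohead (S_reading y (y + 1) (x :: s)) != Some North.
Proof.
move=> xs yx; rewrite S_reading_cons gt_eqF //; case: (eqVneq x (y + 1)) => // xy.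
have high q : ohead (reading id y s) != Some (North, q).
  by apply: (reading_high _ xs); lia.
rewrite -[s in S_reading _ _ s]map_id -reading_steps.
by case: (reading id y s) high => [|[[] q] r] //= /(_ q); rewrite eqxx.
Qed.

(* If the first entries are x > y, the sequence beginning with x meets y + 1
   before y, the other one meets y first. *)
Lemma S_reading_inj s t :
  sorted (drop_at_most1 id) s -> sorted (drop_at_most1 id) t ->
  (forall k, S_reading k (k + 1) s = S_reading k (k + 1) t) -> s = t.
Proof.
elim: s t => [|x s IH] [|y t] //= xs yt st.
- by have := st y; rewrite S_reading_cons eqxx.
- by have := st x; rewrite S_reading_cons eqxx.
have xy : x = y.
  apply/eqP; case: ltgtP => // lt.
    by have := S_reading_above yt lt; rewrite -st S_reading_cons eqxx.
  by have := S_reading_above xs lt; rewrite st S_reading_cons eqxx.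
rewrite -{y}xy in yt st *; congr (_ :: _).
apply: IH (path_sorted xs) (path_sorted yt) _ => k; have := st k.
by rewrite !S_reading_cons; case: eqP => [_ []|_] //; case: eqP => [_ []|_].
Qed.

(** If [Q] were longer than [P] by a nonempty word [D], then [B = D ++ C], and [D] would end with
    the last step of [Q], a North step, giving [B] more North steps than [C]. *)
Lemma cat_north_unique (P Q B C : seq step) :
  P ++ B = Q ++ C -> last North P = North -> last North Q = North ->
  count_mem North B = count_mem North C -> P = Q /\ B = C.
Proof.
wlog PQ : P Q B C / (size P <= size Q)%N => [W|] eqPQ lP lQ BC.
  case: (leqP (size P) (size Q)) => [le|/ltnW le]; first exact: W.
  by have [] := W Q P C B le (esym eqPQ) lQ lP (esym BC).
have eQ : Q = P ++ take (size Q - size P) B.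
  have := congr1 (take (size Q)) eqPQ; rewrite [RHS]take_size_cat // take_cat.
  by rewrite ltnNge PQ.
set D := take _ _ in eQ.
have eB : B = D ++ C.
  by move: eqPQ; rewrite {1}eQ -catA => /eqP; rewrite eqseq_cat // eqxx => /eqP.
have : count_mem North D = 0%N by move: BC; rewrite eB count_cat; lia.
move: lQ; rewrite eQ last_cat lP eB; case/lastP: D {eQ eB} => [|D d]; first by rewrite cats0.
by rewrite last_rcons -cats1 count_cat => -> /=; rewrite addn1.
Qed.

Lemma S_readingN a b v : S_reading (- a) (- b) v = S_reading a b (map -%R v).
Proof.
by elim: v => //= x v IH; rewrite !S_reading_cons IH ![x == - _]eq_sym ![- x == _]eq_sym !eqr_oppLR.
Qed.

Lemma S_reading_cat a b v w : S_reading a b (v ++ w) = S_reading a b v ++ S_reading a b w.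
Proof. exact: pmap_cat. Qed.

Section Decode.
Variables (T : eqType) (f g : T -> int).

(** The lowest level is split off first: [levels_count] gives its number of North steps from the
    word alone, what precedes it ends with a North step by [levels_last], and [cat_north_unique]
    then locates the cut. *)
Lemma levels_decode (k m : nat) s x t y :
  sorted (drop_at_most1 f) (rcons s x) -> sorted (drop_at_most1 g) (rcons t y) ->
  f x <= k%:Z -> g y <= k%:Z ->
  (forall z, z \in rcons s x -> f z < (k + m)%:Z) ->
  (forall z, z \in rcons t y -> g z < (k + m)%:Z) ->
  map fst (levels f k m (rcons s x)) = map fst (levels g k m (rcons t y)) ->
  forall i, (k <= i)%N ->
  map fst (reading f i%:Z (rcons s x)) = map fst (reading g i%:Z (rcons t y)).
Proof.
move=> sx ty; elim: m k => [|m IH] k xk yk fk gk eqL i ki.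
  have nil h r : (forall z, z \in r -> h z < (k + 0)%:Z) -> reading h i%:Z r = [::].
    elim: r => // z r IHr hk; rewrite reading_cons IHr; last first.
      by move=> z' zr; apply: hk; rewrite inE zr orbT.
    have := hk z (mem_head _ _); case: eqP => [|_]; first by lia.
    by case: eqP => //; lia.
  by rewrite !nil.
have cN h r : count_mem North (map fst (reading h k%:Z r)) = count (fun z : T => h z == k%:Z) r.
  by rewrite -size_labels labels_north size_filter.
have cc : count (fun z => f z == k%:Z) (rcons s x) = count (fun z => g z == k%:Z) (rcons t y).
  by have := levels_count fk; rewrite eqL (levels_count gk); lia.
have xk1 : f x <= k.+1%:Z by lia.
have yk1 : g y <= k.+1%:Z by lia.
move: eqL; rewrite !levelsS !map_cat => eqL.
have [|eqP eqB] := cat_north_unique eqL (levels_last m sx xk1) (levels_last m ty yk1).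
  by rewrite !cN.
have [ltki|] := ltnP k i.
  by apply: IH ltki => // z /[dup] zs; [move/fk|move/gk]; lia.
by move=> ik; have -> : i = k by lia.
Qed.

End Decode.

(** * The sequence [lambda] of a word, and its rises *)

Lemma iotaS m n : iota m.+1 n = map S (iota m n).
Proof. by rewrite -(addn1 m) addnC iotaDl. Qed.

Lemma iotaSr m n : iota m n.+1 = rcons (iota m n) (m + n)%N.
Proof. by rewrite -(addn1 n) iotaD cats1. Qed.

Lemma lambda_seq_north w : lambda_seq (North :: w) = 0%N :: lambda_seq w.
Proof.
by rewrite /lambda_seq /= iotaS filter_map -map_comp.
Qed.

Lemma lambda_seq_east w : lambda_seq (East :: w) = map S (lambda_seq w).
Proof.
by rewrite /lambda_seq /= iotaS filter_map -!map_comp.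
Qed.

Lemma size_lambda_seq w : size (lambda_seq w) = count_mem North w.
Proof.
elim: w => // -[] w IH; first by rewrite lambda_seq_north /= IH.
by rewrite lambda_seq_east size_map IH.
Qed.

Lemma lambda_seq_le w x : x \in lambda_seq w -> (x <= count_mem East w)%N.
Proof.
elim: w x => // -[] w IH x; rewrite ?lambda_seq_north ?lambda_seq_east /=.
  by rewrite inE => /orP[/eqP->//|/IH].
by case/mapP => y /IH yw ->.
Qed.

Lemma lambda_seq_sorted w : sorted leq (lambda_seq w).
Proof.
elim: w => // -[] w IH; rewrite ?lambda_seq_north ?lambda_seq_east.
  by case: (lambda_seq w) IH.
by rewrite sorted_map.
Qed.

(** East steps after the last North step leave no trace in [lambda_seq]; the equality of sizes
    recovers them. *)
Lemma lambda_seq_inj w v : size w = size v -> lambda_seq w = lambda_seq v -> w = v.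
Proof.
elim: w v => [|d w IH] [|c v] //= [/IH {}IH].
case: d; case: c; rewrite ?lambda_seq_north ?lambda_seq_east.
- by case=> /IH->.
- by case: (lambda_seq v).
- by case: (lambda_seq w).
- by move/(inj_map succn_inj)/IH->.
Qed.

Lemma riseE w i :
  rise w i = has (fun k => [&& onth w k == Some North, onth w k.+1 == Some North
                             & count_mem North (take k.+1 w) == i]) (iota 0 (size w)).
Proof.
apply/existsP/hasP => [[k wk]|[k]]; first by exists (val k) => //; rewrite mem_iota /=.
by rewrite mem_iota /= => kw wk; exists (Ordinal kw).
Qed.

Lemma rise_east w i : rise (East :: w) i = rise w i.
Proof. by rewrite !riseE /= iotaS has_map. Qed.

Lemma rise_north w i :
  rise (North :: w) i
  = (i == 1%N) && (ohead w == Some North) || (0 < i)%N && rise w i.-1.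
Proof.
rewrite !riseE /= iotaS has_map take0 /= addn0; congr orb.
  by rewrite andbC [1%N == i]eq_sym; case: w.
case: i => [|i] /=; last by apply: eq_has => k /=; rewrite add1n eqSS.
by rewrite (eq_has (a2 := pred0)) ?has_pred0 // => k /=; rewrite !andbF.
Qed.

(** Two successive entries of [lambda_seq] agree exactly when no East step separates the
    corresponding North steps; the bound [i < count_mem North w] keeps the default value of [nth]
    out. *)
Lemma rise_lambda w i :
  rise w i = [&& (0 < i)%N, (i < count_mem North w)%N
               & nth 0%N (lambda_seq w) i.-1 == nth 0%N (lambda_seq w) i].
Proof.
elim: w i => [|[] w IH] i.
- by rewrite riseE /= andbF.
- rewrite rise_north lambda_seq_north IH /= add1n ltnS.
  case: i => [|[|i]] //=; rewrite orbF -size_lambda_seq.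
  by case: w {IH} => // -[] w; rewrite ?lambda_seq_north ?lambda_seq_east //; case: lambda_seq.
rewrite rise_east lambda_seq_east IH /= add0n.
case: i => //= i; rewrite -size_lambda_seq; case: (ltnP i.+1) => //= iw.
by rewrite !(nth_map 0%N 0%N succn) ?eqSS ?(ltnW iw).
Qed.

Lemma head_lambda w : (0 < count_mem North w)%N ->
  (head East w == North) = (nth 0%N (lambda_seq w) 0 == 0%N).
Proof.
rewrite -size_lambda_seq.
by case: w => // -[] w; rewrite ?lambda_seq_north ?lambda_seq_east //; case: lambda_seq.
Qed.

(* The area vector, extended to an odd function on the positions -n, ..., n. *)
Definition area (n : nat) (p : lattice_path n n) (x : int) : int :=
  sgz x * mu p (n.+1 - `|x|)%N.

(** * Values of the extended area vector *)

Section Area.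
Variables (n : nat) (p : lattice_path n n).
Local Notation A := (area p).

Lemma count_path d : count_mem d (p : seq step) = n.
Proof. by case: d; have /andP[/eqP ? /eqP ?] := valP p. Qed.

Lemma size_path : size p = (n + n)%N.
Proof. by rewrite size_tuple. Qed.

Lemma areaN x : A (- x) = - A x.
Proof. by rewrite /area sgzN abszN mulNr. Qed.

Lemma area0 : A 0 = 0.
Proof. by rewrite /area sgz0 mul0r. Qed.

Lemma areaS j : (j < n)%N -> A j.+1 = j.+1%:Z - (nth 0%N (lambda_seq p) j)%:Z.
Proof.
move=> jn; rewrite /area /mu /lambda absz_nat.
by rewrite (_ : (n.+1 - (n.+1 - j.+1)) = j.+1)%N ?mul1r //; lia.
Qed.

Lemma lambda_nth_le i : (nth 0%N (lambda_seq p) i <= n)%N.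
Proof.
have [/(mem_nth 0%N)/lambda_seq_le|/(nth_default 0%N)->//] := ltnP i (size (lambda_seq p)).
by rewrite count_path.
Qed.

Lemma lambda_nth_step j :
  (j.+1 < n)%N -> (nth 0%N (lambda_seq p) j <= nth 0%N (lambda_seq p) j.+1)%N.
Proof.
by move=> jn; apply: (sortedP 0%N (lambda_seq_sorted p)); rewrite size_lambda_seq count_path.
Qed.

Lemma area_bound j : (0 < j <= n)%N -> - n%:Z <= A j <= n%:Z.
Proof.
by case: j => // j jn; rewrite areaS //; have := lambda_nth_le j; lia.
Qed.

Lemma rise_area j : rise p j = (0 < j < n)%N && (A j.+1 == A j + 1).
Proof.
rewrite rise_lambda count_path andbA; case: j => //= j; case: ltnP => // jn.
by rewrite !areaS //; [apply/eqP/eqP; lia| exact: ltnW].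
Qed.

Lemma head_area : (0 < n)%N -> (head East p == North) = (A 1 == 1).
Proof.
by move=> n0; rewrite head_lambda ?count_path // areaS //; apply/eqP/eqP; lia.
Qed.

End Area.

Lemma area_inj n (p q : lattice_path n n) :
  (forall j, (0 < j <= n)%N -> area p j = area q j) -> p = q.
Proof.
move=> pq; suff eqL : lambda_seq p = lambda_seq q.
  by apply/val_inj/val_inj/(lambda_seq_inj _ eqL); rewrite !size_tuple.
apply: (@eq_from_nth _ 0%N) => [|j]; first by rewrite !size_lambda_seq !count_path.
rewrite size_lambda_seq count_path => jn.
by have := pq j.+1 jn; rewrite !areaS //; lia.
Qed.

(** * The cyclic order of the positions *)

Definition positives (n : nat) : seq int := [seq k%:Z | k <- iota 1 n].

(** The area vector lists [area] at [n, ..., 1]. Read right to left with signs changed, it lists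
    [area] at [-1, ..., -n], by oddness. The two readings of each level of [zetaC] thus become a
    single pass along this sequence. *)
Definition reading_order (n : nat) : seq int :=
  map -%R (positives n) ++ rev (positives n).

Lemma rev_reading_order n : rev (reading_order n) = map -%R (reading_order n).
Proof.
rewrite /reading_order rev_cat revK map_cat map_rev -map_comp; congr (_ ++ _).
by rewrite -[LHS]map_id; apply: eq_map => x /=; rewrite opprK.
Qed.

Lemma rcons_reading_order n :
  rcons (reading_order n) 0
  = [seq - k%:Z | k <- iota 1 n] ++ rev [seq k%:Z | k <- iota 0 n.+1].
Proof. by rewrite rcons_cat /positives /= rev_cons -map_comp. Qed.

Lemma mem_reading_order n x : (x \in rcons (reading_order n) 0) = (`|x| <= n)%N.
Proof.
rewrite rcons_reading_order mem_cat mem_rev; apply/orP/idP => [[]/mapP[k]|xn].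
- by rewrite mem_iota => kn ->; lia.
- by rewrite mem_iota => kn ->; lia.
case: (lerP 0 x) => x0; [right|left]; apply/mapP; exists `|x|%N; rewrite ?mem_iota; lia.
Qed.

Variant consecutive_spec (n : nat) (x y : int) : Prop :=
| ConsecutiveNeg j of (0 < j < n)%N & x = - j%:Z & y = - j.+1%:Z
| ConsecutiveTurn of x = - n%:Z & y = n%:Z
| ConsecutivePos j of (j < n)%N & x = j.+1%:Z & y = j%:Z.

Lemma consecutiveP n x y : (0 < n)%N ->
  reflect (consecutive_spec n x y) (infix [:: x; y] (rcons (reading_order n) 0)).
Proof.
case: n => // n _; rewrite rcons_reading_order.
have neg : [seq - k%:Z | k <- iota 1 n.+1] = rcons [seq - k%:Z | k <- iota 1 n] (- n.+1%:Z).
  by rewrite iotaSr map_rcons add1n.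
have pos : ohead (rev [seq k%:Z | k <- iota 0 n.+2]) = Some n.+1%:Z.
  by rewrite iotaSr map_rcons rev_rcons.
rewrite {1}neg infix2_cat -neg pos -infix_revLR.
apply: (iffP or3P).
  case=> [/infix2_iota[j jn [-> ->]]|/andP[/eqP-> /eqP[<-]]|/infix2_iota[j jn [-> ->]]].
  - by apply: (ConsecutiveNeg (j := j)) => //; lia.
  - exact: ConsecutiveTurn.
  - by apply: (ConsecutivePos (j := j)) => //; lia.
case=> [j jn -> ->|-> ->|j jn -> ->].
- by apply: Or31; apply/infix2_iota; exists j => //; lia.
- by apply: Or32; rewrite !eqxx.
- by apply: Or33; apply/infix2_iota; exists j => //; lia.
Qed.

Lemma rev_iota1 m : rev (iota 1 m) = [seq (m.+1 - j)%N | j <- iota 1 m].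
Proof.
apply: (@eq_from_nth _ 0%N) => [|i]; first by rewrite size_rev size_map.
rewrite size_rev size_iota => im; rewrite nth_rev ?size_iota //.
by rewrite (nth_map 0%N) ?size_iota // !nth_iota; lia.
Qed.

(** * The zeta map as a concatenation of levels *)

Section Zeta.
Variables (n : nat) (p : lattice_path n n).
Local Notation A := (area p).

(** On the negative and on the positive stretch this is the monotonicity of [lambda]; at the turn
    from [-n] to [n] it comes from [lambda_n <= n], and from [1] to [0] from [lambda_1 >= 0]. *)
Lemma area_drop_at_most1 : (0 < n)%N -> sorted (drop_at_most1 A) (rcons (reading_order n) 0).
Proof.
move=> n_gt0; apply: infix2_sorted => x y /(consecutiveP _ _ n_gt0)[j jn -> ->|-> ->|j jn -> ->];
  rewrite /drop_at_most1.
- case: j jn => // j jn; rewrite !areaN !areaS; [|lia..].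
  by have := @lambda_nth_step _ p j; lia.
- rewrite areaN; case: n p n_gt0 => // m q _; rewrite areaS //.
  by have := lambda_nth_le q m; lia.
case: j jn => [|j] jn; first by rewrite area0 areaS //; lia.
by rewrite !areaS; [have := @lambda_nth_step _ p j; lia| lia..].
Qed.

Lemma area_lt x : x \in rcons (reading_order n) 0 -> A x < (0 + n.+1)%:Z.
Proof.
rewrite mem_reading_order; case: x => [[|j]|j] xn; first by rewrite area0.
  by have := @area_bound _ p j.+1 xn; lia.
rewrite NegzE areaN; have := @area_bound _ p j.+1; lia.
Qed.

Lemma area_vectorE : area_vector p = map A (rev (positives n)).
Proof.
rewrite /area_vector /positives -map_rev rev_iota1 -!map_comp.
apply/eq_in_map => i; rewrite mem_iota => i_n /=.
rewrite /area absz_nat (_ : (n.+1 - (n.+1 - i)) = i)%N; last by lia.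
by rewrite gtr0_sgz ?mul1r //; lia.
Qed.

Definition labelled_zeta : seq (step * int) := levels A 0 n.+1 (reading_order n).

Lemma zetaC_labelled : zetaC p = map fst labelled_zeta.
Proof.
rewrite /zetaC /labelled_zeta /levels map_flatten -map_comp; congr flatten.
apply: eq_map => k /=; rewrite reading_steps map_cat S_reading_cat -area_vectorE.
congr (_ ++ _); rewrite /S_minus_left -opprD S_readingN area_vectorE -map_rev revK.
by rewrite -!map_comp; congr S_reading; apply: eq_map => x /=; rewrite areaN.
Qed.

(** The position 0 has value 0, so it is read only at level 0, as a final North step. This appended
    step turns the valley convention for a final East step into an ordinary valley. *)
Lemma rcons_labelled_zeta :
  rcons labelled_zeta (North, 0) = levels A 0 n.+1 (rcons (reading_order n) 0).
Proof.
rewrite /labelled_zeta !levelsS reading_rcons reading_cons area0 eqxx rcons_cat cats1.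
congr (_ ++ _); rewrite /levels; congr flatten; apply/eq_in_map => k.
rewrite mem_rev mem_iota => k0; rewrite reading_rcons reading_cons area0.
have [/negPf-> /negPf->] : (0 : int) != k%:Z /\ (0 : int) != k%:Z + 1 by lia.
by rewrite cats0.
Qed.

Lemma labelled_zeta_infix x y : (0 < n)%N ->
  infix [:: (East, x); (North, y)] (rcons labelled_zeta (North, 0))
  = [&& infix [:: x; y] (rcons (reading_order n) 0), A x == A y + 1 & 0 <= A y].
Proof.
move=> n_gt0; rewrite rcons_labelled_zeta levels_infix ?area0 //; last exact: area_drop_at_most1.
case xy : infix => //=; congr andb; rewrite andb_idr // => _.
by apply: area_lt; apply: (mem_infix xy); rewrite !inE eqxx orbT.
Qed.

Lemma zetaC_ballot : ballot_word (zetaC p).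
Proof.
apply/forallP => -[t t_le] /=; rewrite zetaC_labelled; apply: levels_ballot => x xn.
by apply: area_lt; rewrite mem_rcons inE xn orbT.
Qed.

End Zeta.

(** * Injectivity of the zeta map on paths *)

Lemma S_reading_swap a b v : a != b ->
  S_reading b a v = [seq (if d is North then East else North) | d <- S_reading a b v].
Proof.
move=> ab; elim: v => //= x v IH; rewrite !S_reading_cons IH.
by case: (eqVneq x a) ab => [->/negPf->|_ _] /=; [rewrite ?eqxx | case: eqP].
Qed.

Lemma S_reading_rev a b v : S_reading a b (rev v) = rev (S_reading a b v).
Proof.
elim: v => //= x v IH; rewrite rev_cons -cats1 S_reading_cat IH !S_reading_cons.
by case: ifP => _; [|case: ifP => _]; rewrite ?rev_cons ?cats0 ?cats1.
Qed.

(** Reversing [v] negates it, which exchanges [k, k + 1] with [-k, -k - 1]. Hence the nonnegative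
    levels of an odd sequence determine the negative ones. *)
Lemma S_reading_odd k v : rev v = map -%R v ->
  S_reading (- k - 1) (- k) v
  = rev [seq (if d is North then East else North) | d <- S_reading k (k + 1) v].
Proof.
move=> v_odd; rewrite -map_rev -S_reading_rev v_odd -S_readingN opprD.
by rewrite S_reading_swap //; lia.
Qed.

Lemma zetaC_inj n (p q : lattice_path n n) : (0 < n)%N -> zetaC p = zetaC q -> p = q.
Proof.
move=> n0 pq.
pose s (r : lattice_path n n) := map (area r) (reading_order n).
have s_odd r : rev (s r) = map -%R (s r).
  by rewrite -map_rev rev_reading_order -!map_comp; apply: eq_map => x /=; rewrite areaN.
have eq_nat (k : nat) : S_reading k%:Z (k%:Z + 1) (s p) = S_reading k%:Z (k%:Z + 1) (s q).
  have eqL : map fst (levels (area p) 0 n.+1 (rcons (reading_order n) 0))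
             = map fst (levels (area q) 0 n.+1 (rcons (reading_order n) 0)).
    by rewrite -!rcons_labelled_zeta // !map_rcons -!zetaC_labelled pq.
  have := levels_decode (area_drop_at_most1 p n0) (area_drop_at_most1 q n0) _ _
    (@area_lt _ p) (@area_lt _ q) eqL (leq0n k).
  rewrite !reading_steps !map_rcons !area0 -!cats1 !S_reading_cat => /(_ isT isT) eqS.
  (* Both words end with the reading of the entry 0, which is cut off by comparing lengths. *)
  have /eqP := eqS; rewrite eqseq_cat; first by case/andP=> /eqP.
  by apply: (@addIn (size (S_reading k (k%:Z + 1) [:: 0]))); rewrite -!size_cat eqS.
have sP : s p = s q.
  apply: S_reading_inj => [||k]; rewrite ?sorted_map.
  - by have := area_drop_at_most1 p n0; rewrite -cats1 => /cat_sorted2[].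
  - by have := area_drop_at_most1 q n0; rewrite -cats1 => /cat_sorted2[].
  case: (lerP 0 k) => k0; first by case: k k0.
  (* A negative [k] equals [- m - 1] for [m = |k + 1|], so its reading follows from that of level
     [m]. *)
  have := S_reading_odd (absz (k + 1))%:Z; rewrite (_ : - _ - 1 = k); last by lia.
  by rewrite (_ : - _ = k + 1); last lia; move=> odd; rewrite !odd ?s_odd // eq_nat.
apply: area_inj => j jn; move/eq_in_map: sP; apply.
by have := mem_reading_order n j; rewrite mem_rcons inE; lia.
Qed.

(** * The order in which the diagonal word visits the positions *)

Lemma flatten_shift (T : Type) (F G : nat -> seq T) m :
  F 0%N ++ flatten [seq G i ++ F i.+1 | i <- iota 0 m]
  = flatten [seq F i ++ G i | i <- iota 0 m] ++ F m.
Proof.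
elim: m => [|m IH]; first by rewrite cats0.
by rewrite iotaSr !map_rcons !flatten_rcons add0n !catA IH.
Qed.

Lemma rev_flatten_map (T : Type) (F : nat -> seq T) s :
  flatten [seq rev (F i) | i <- rev s] = rev (flatten [seq F i | i <- s]).
Proof. by rewrite rev_flatten map_rev -map_comp. Qed.

Lemma perm_flatten_filter (T : eqType) (f : T -> int) (s : seq T) (r : seq nat) : uniq r ->
  perm_eq (flatten [seq [seq x <- s | f x == i%:Z] | i <- r])
          [seq x <- s | f x \in map Posz r].
Proof.
elim: r => [|i r IH] /=; first by rewrite filter_pred0.
case/andP=> ir /IH{}IH.
rewrite (perm_trans (perm_cat (perm_refl _) IH)) // perm_sym.
rewrite (perm_trans (y := [seq x <- [seq x <- s | f x \in i%:Z :: map Posz r] | f x == i%:Z]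
   ++ [seq x <- [seq x <- s | f x \in i%:Z :: map Posz r] | f x != i%:Z])) //.
  by rewrite perm_sym; apply/permPl/perm_filterC.
rewrite -!filter_predI.
rewrite (eq_filter (a2 := fun x => f x == i%:Z)); last first.
  by move=> x /=; rewrite inE; case: eqP.
rewrite (eq_filter (a1 := predI _ (fun x => f x \in _)) (a2 := fun x => f x \in map Posz r)) //.
move=> x /=; rewrite inE; case: eqP => //= ->; rewrite mem_map //; first by rewrite (negPf ir).
by move=> ? ? [].
Qed.

Lemma size_steps (w : seq step) : size w = (count_mem North w + count_mem East w)%N.
Proof. by elim: w => //= -[] w /= ->; lia. Qed.

Section Order.
Variables (n : nat) (p : lattice_path n n).
Local Notation A := (area p).

(** This is [-n, ..., -1], matching the decreasing order of [j] in [dC]. *)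
Definition negatives : seq int := rev (map -%R (positives n)).
Definition pos_at (k : nat) := [seq x <- positives n | A x == k%:Z].
Definition neg_at (k : nat) := [seq x <- negatives | A x == k%:Z].

(** [dC p u] is the image of this sequence under [u] ([dC_order]): the order of reading depends on
    the path alone. *)
Definition diag_order : seq int :=
  flatten [seq neg_at i ++ pos_at i.+1 | i <- iota 0 n.+1].

Lemma level_rev (k : nat) :
  [seq x <- reading_order n | A x == k%:Z] = rev (pos_at k ++ neg_at k).
Proof.
by rewrite -filter_cat -filter_rev /negatives rev_cat revK.
Qed.

Lemma level_out x : x \in positives n ++ negatives -> A x != n.+1%:Z.
Proof.
rewrite mem_cat mem_rev => xn.
have : x \in rcons (reading_order n) 0.
  by rewrite mem_rcons inE mem_cat mem_rev; case/orP: xn => ->; rewrite !orbT.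
by move=> xr; have := area_lt p xr; lia.
Qed.

Lemma neg_at_out : neg_at n.+1 = [::].
Proof.
apply/eqP; rewrite -[_ == _]negbK -has_filter; apply/hasPn => x xn.
by apply: level_out; rewrite mem_cat xn orbT.
Qed.

Lemma pos_at_out : pos_at n.+1 = [::].
Proof.
apply/eqP; rewrite -[_ == _]negbK -has_filter; apply/hasPn => x xn.
by apply: level_out; rewrite mem_cat xn.
Qed.

(** Reversed, level [k] has the East labels [pos_at k.+1 ++ neg_at k.+1]; [flatten_shift] regroups
    them into the blocks [neg_at i ++ pos_at i.+1], of which only [neg_at 0] was missing. *)
Lemma diag_order_east :
  diag_order = neg_at 0 ++ rev (labels East (labelled_zeta p)).
Proof.
rewrite /labelled_zeta /levels labels_flatten -map_comp.
rewrite (eq_map (g := fun k : nat => rev (pos_at k.+1 ++ neg_at k.+1))); last first.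
  by move=> k /=; rewrite labels_east -level_rev intS addrC.
rewrite rev_flatten_map revK (flatten_shift neg_at (fun i => pos_at i.+1)).
by rewrite neg_at_out cats0.
Qed.

(** The same regrouping one value lower: here [pos_at 0] is in excess. *)
Lemma diag_order_north :
  pos_at 0 ++ diag_order = rev (labels North (labelled_zeta p)).
Proof.
rewrite /labelled_zeta /levels labels_flatten -map_comp.
rewrite (eq_map (g := fun k : nat => rev (pos_at k ++ neg_at k))); last first.
  by move=> k /=; rewrite labels_north -level_rev.
by rewrite rev_flatten_map revK flatten_shift pos_at_out cats0.
Qed.

(** As [area] is odd, its zeros come in opposite pairs. This accounts for the labels [w(n - j)] with
    [j > n] in [north_label]. *)
Lemma pos_at0 : pos_at 0 = rev (map -%R (neg_at 0)).
Proof.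
rewrite /pos_at /neg_at /negatives -map_rev -filter_rev revK filter_map -map_comp.
rewrite -[LHS]map_id; rewrite (eq_map (g := -%R \o -%R)); last by move=> x /=; rewrite opprK.
by congr map; apply: eq_filter => x /=; rewrite areaN oppr_eq0.
Qed.

(** Each [j] is visited once: as [-j] when [A j <= 0], as [j] when [A j > 0]. *)
Lemma perm_diag_order : perm_eq (map absz diag_order) (iota 1 n).
Proof.
have mem_levels v : (v \in map Posz (iota 0 n.+1)) = (0 <= v <= n%:Z).
  apply/mapP/idP => [[k]|v_n]; first by rewrite mem_iota; lia.
  by exists `|v|%N; rewrite ?mem_iota; lia.
(* The index of the block of [diag_order] that may contain [x]: positive positions of value [i + 1]
   stand in block [i], negative ones of value [i] too. *)
pose f (x : int) := if 0 <= x then A x - 1 else A x.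
have -> : diag_order = flatten [seq [seq x <- negatives ++ positives n | f x == i%:Z]
                               | i <- iota 0 n.+1].
  congr flatten; apply: eq_map => i; rewrite filter_cat; congr (_ ++ _).
    apply: eq_in_filter => x; rewrite mem_rev => /mapP[y /mapP[k]].
    by rewrite mem_iota => kn -> ->; rewrite /f (_ : 0 <= - k%:Z = false) //; lia.
  apply: eq_in_filter => x /mapP[k]; rewrite mem_iota => kn ->; rewrite /f /= intS.
  by rewrite addrC subr_eq addrC.
rewrite (perm_trans (perm_map _ (perm_flatten_filter _ _ (iota_uniq _ _)))) //.
rewrite filter_cat map_cat /negatives /positives -map_comp filter_rev map_rev.
rewrite !filter_map -!map_comp.
have e1 : [seq j <- iota 1 n | preim (-%R \o Posz) (fun x => f x \in map Posz (iota 0 n.+1)) j]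
          = [seq j <- iota 1 n | A j%:Z <= 0].
  apply: eq_in_filter => j; rewrite mem_iota => jn; rewrite [LHS]mem_levels /f /=.
  rewrite (_ : 0 <= - j%:Z = false); last by lia.
  by rewrite areaN; have := @area_bound _ p j; lia.
have e2 : [seq j <- iota 1 n | preim Posz (fun x => f x \in map Posz (iota 0 n.+1)) j]
          = [seq j <- iota 1 n | ~~ (A j%:Z <= 0)].
  apply: eq_in_filter => j; rewrite mem_iota => jn; rewrite [LHS]mem_levels /f /=.
  by have := @area_bound _ p j; lia.
rewrite e1 e2 (eq_map (g := id)) ?map_id; last by move=> j /=; rewrite abszN.
rewrite (perm_trans _ (permEl (perm_filterC (fun j : nat => A j%:Z <= 0) _))) //.
by rewrite perm_cat2r perm_rev.
Qed.

Lemma size_diag_order : size diag_order = n.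
Proof. by rewrite -(size_map absz) (perm_size perm_diag_order) size_iota. Qed.

(** If [area] has [z] zeros among the positive positions, there are [n + z] North steps and [n - z]
    East steps. *)
Lemma size_zetaC : size (zetaC p) = (2 * n)%N.
Proof.
rewrite size_steps zetaC_labelled -!size_labels.
have := congr1 size diag_order_east; rewrite size_diag_order size_cat size_rev.
have := congr1 size diag_order_north.
rewrite size_cat size_diag_order pos_at0 size_rev size_map size_rev => <- e.
by rewrite addnAC -e; lia.
Qed.

End Order.

(** * Signed permutations and their windows *)

Lemma mem_pm_seq n x : (x \in pm_seq n) = (0 < `|x| <= n)%N.
Proof.
rewrite mem_cat; apply/orP/idP => [[]/mapP[k]|xn].
- by rewrite mem_iota => kn ->; lia.
- by rewrite mem_iota => kn ->; lia.
case: (lerP 0 x) => x0; [left|right]; apply/mapP; exists `|x|%N; rewrite ?mem_iota; lia.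
Qed.

Section SignedPerm.
Variables (n : nat) (u : signed_perm n).

Lemma signed_perm_val (x : pm n) : u (val x) = val (val u x).
Proof. by rewrite /signed_perm_fun /perm_at valK. Qed.

Lemma signed_perm_out x : ~~ (0 < `|x| <= n)%N -> u x = 0.
Proof.
by rewrite -mem_pm_seq => xn; rewrite /signed_perm_fun /perm_at insubN.
Qed.

Lemma signed_perm0 : u 0 = 0.
Proof. exact: signed_perm_out. Qed.

Lemma signed_permN x : u (- x) = - u x.
Proof.
have [xn|xn] := boolP (0 < `|x| <= n)%N; last first.
  by rewrite !signed_perm_out ?oppr0 // abszN.
rewrite -mem_pm_seq in xn.
by have /forallP/(_ (SeqSub xn))/eqP := valP u.
Qed.

Lemma signed_perm_abs x : (0 < `|x| <= n)%N -> (0 < `|u x| <= n)%N.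
Proof.
rewrite -!mem_pm_seq => xn; rewrite -[x]/(val (SeqSub xn)) signed_perm_val; exact: valP.
Qed.

Lemma signed_perm_inj : {in pm_seq n &, injective u}.
Proof.
move=> x y xn yn; rewrite -[x]/(val (SeqSub xn)) -[y]/(val (SeqSub yn)) !signed_perm_val.
by move=> /val_inj/perm_inj->.
Qed.

Lemma nth_window k : (k < n)%N -> nth 0 (window u) k = u k.+1%:Z.
Proof. by move=> kn; rewrite (nth_map 0%N) ?size_iota // nth_iota. Qed.

Lemma perm_abs_signed_perm s :
  perm_eq (map absz s) (iota 1 n) -> perm_eq (map absz (map u s)) (iota 1 n).
Proof.
move=> sn; pose h (k : nat) := absz (u k%:Z).
have -> : map absz (map u s) = map h (map absz s).
  rewrite -!map_comp; apply: eq_map => -[k|k] //=.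
  by rewrite /h /= NegzE signed_permN abszN.
rewrite (perm_trans (perm_map h sn)) //.
have un : uniq (map h (iota 1 n)).
  rewrite map_inj_in_uniq ?iota_uniq // => i j; rewrite !mem_iota /h => i_n j_n ij.
  (* Equal absolute values mean [u i = u j] or [u i = - u j = u (- j)]; the latter would give
     [i = - j] for positive [i] and [j]. *)
  have : u i%:Z = u j%:Z \/ u i%:Z = u (- j%:Z) by rewrite signed_permN; lia.
  by case=> /signed_perm_inj; rewrite !mem_pm_seq; lia.
have sub : {subset map h (iota 1 n) <= iota 1 n}.
  move=> _ /mapP[k kn ->]; rewrite !mem_iota in kn *.
  by have := @signed_perm_abs k; rewrite /h; lia.
have [] := uniq_min_size un sub; first by rewrite size_map.
by move=> _ eqm; apply: uniq_perm; rewrite ?iota_uniq.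
Qed.

End SignedPerm.

Lemma window_surj n (v : seq int) :
  perm_eq (map absz v) (iota 1 n) -> exists w : signed_perm n, window w = v.
Proof.
move=> vn; have size_v : size v = n by rewrite -(size_map absz) (perm_size vn) size_iota.
(* The odd extension of the window, with value 0 at 0. *)
pose g (x : int) : int := sgz x * nth 0 v `|x|.-1.
have gN x : g (- x) = - g x by rewrite /g sgzN abszN mulNr.
have vP k : (k < n)%N -> (0 < `|nth 0%R v k| <= n)%N.
  move=> kn; have : absz (nth 0 v k) \in iota 1 n.
    by rewrite -(perm_mem vn) map_f // mem_nth ?size_v.
  by rewrite mem_iota; lia.
have g_abs x : (0 < `|x| <= n)%N -> `|g x|%N = `|nth 0%R v `|x|.-1|%N.
  by move=> xn; rewrite abszM absz_sg (_ : (x == 0) = false) ?mul1n //; lia.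
have g_pm (x : pm n) : g (val x) \in pm_seq n.
  have xn : (0 < `|val x| <= n)%N by rewrite -mem_pm_seq; apply: valP.
  by rewrite mem_pm_seq g_abs // vP //; lia.
have g_inj : injective (fun x : pm n => SeqSub (g_pm x) : pm n).
  move=> x y [gxy]; apply: val_inj.
  have xn : (0 < `|val x| <= n)%N by rewrite -mem_pm_seq; apply: valP.
  have yn : (0 < `|val y| <= n)%N by rewrite -mem_pm_seq; apply: valP.
  have : `|val x|.-1 = `|val y|.-1.
    apply/eqP; rewrite -(@nth_uniq _ 0%N (map absz v)) ?size_map ?size_v; [|lia|lia|].
      by rewrite !(nth_map 0) ?size_v; [rewrite -!g_abs // gxy|lia|lia].
    by rewrite (perm_uniq vn) iota_uniq.
  (* If [x = - y], oddness gives [g y = - g y], so [g y = 0], which is not an allowed value. *)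
  move=> exy; have [//|xy] : val x = val y \/ val x = - val y by lia.
  have gy : g (val y) = - g (val y) by rewrite -gN -xy -[LHS]gxy.
  have : g (val y) = 0 by lia.
  by have := g_pm y; rewrite mem_pm_seq => /[swap] ->.
pose w := perm g_inj.
have wE (x : pm n) : perm_at w (val x) = g (val x) by rewrite /perm_at valK permE.
have w_odd : [forall k : pm n, perm_at w (- val k) == - perm_at w (val k)].
  apply/forallP => x; have xn : - val x \in pm_seq n.
    by rewrite mem_pm_seq abszN -mem_pm_seq; apply: valP.
  by rewrite wE -[- _]/(val (SeqSub xn : pm n)) wE /= gN.
exists (Sub w w_odd); apply: (@eq_from_nth _ 0) => [|k]; first by rewrite size_map size_iota.
rewrite size_map size_iota => kn; rewrite nth_window // /signed_perm_fun SubK.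
have kn' : k.+1%:Z \in pm_seq n by rewrite mem_pm_seq; lia.
by rewrite -[k.+1%:Z]/(val (SeqSub kn' : pm n)) wE /g /= mul1r.
Qed.

(** * Valleys as factors of a word *)

Lemma onth_drop (T : Type) (w : seq T) k : onth w k = ohead (drop k w).
Proof. by elim: w k => [|c w IH] [|k] //; apply: IH. Qed.

Local Arguments onth : simpl never.

Lemma valleyP w i j :
  reflect (exists w1 w2, [/\ w = w1 ++ [:: East, North & w2],
             i = (count_mem East w1).+1 & j = (count_mem North w1).+1])
          (valley w i j).
Proof.
have take1 (w1 w2 : seq step) c d :
    take (size w1).+1 (w1 ++ [:: c, d & w2]) = rcons w1 c.
  by rewrite -cat_rcons take_size_cat ?size_rcons.
have take2 (w1 w2 : seq step) c d :
    take (size w1).+2 (w1 ++ [:: c, d & w2]) = rcons (rcons w1 c) d.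
  by rewrite -!cat_rcons take_size_cat ?size_rcons.
apply: (iffP existsP) => [[[k kw] /=]|[w1 [w2 [-> -> ->]]]]; last first.
  have kw : (size w1 < size (w1 ++ [:: East, North & w2]))%N by rewrite size_cat /=; lia.
  exists (Ordinal kw) => /=; rewrite !onth_drop take1 take2 -!cats1 !count_cat /=.
  by rewrite drop_size_cat // -(add1n (size w1)) -drop_drop drop_size_cat //= !addn0 !addn1 !eqxx.
case/and4P; rewrite !onth_drop -(add1n k) -drop_drop.
case ew: (drop k w) => [|c [|d w2]] //= /eqP[] ce /eqP[] de /eqP<- /eqP<-.
rewrite {}ce {}de in ew; have {}ew : take k w ++ [:: East, North & w2] = w.
  by rewrite -ew cat_take_drop.
have sz : size (take k w) = k by rewrite size_takel // ltnW.
exists (take k w), w2; split=> //.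
  by have := take1 (take k w) w2 East North; rewrite ew sz => ->; rewrite -cats1 count_cat addn1.
have := take2 (take k w) w2 East North; rewrite ew sz => ->.
by rewrite -!cats1 !count_cat /= !addn0 addn1.
Qed.

(** Appending a North step makes the extra valley at a final East step an ordinary one. *)
Lemma ballot_valleyP w i j :
  reflect (exists w1 w2, [/\ rcons w North = w1 ++ [:: East, North & w2],
             i = (count_mem East w1).+1 & j = (count_mem North w1).+1])
          (ballot_valley w i j).
Proof.
apply: (iffP orP) => [[/valleyP[w1 [w2 [-> -> ->]]]|]|[w1 [w2 []]]].
- by exists w1, (rcons w2 North); rewrite rcons_cat.
- case/lastP: w => // w c /and3P[]; rewrite last_rcons => /eqP-> /eqP<- /eqP<-.
  exists w, [::]; rewrite -!cats1 -catA; split=> //; rewrite count_cat /= ?addn1 ?addn0 //.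
case/lastP: w2 => [|w2 c].
  rewrite -cat_rcons cats1 => /rcons_inj[->] -> ->; right.
  by rewrite last_rcons -cats1 !count_cat /= !addn0 addn1 !eqxx.
rewrite -!rcons_cons -rcons_cat => /rcons_inj[-> _] -> ->; left.
by apply/valleyP; exists w1, w2.
Qed.

(** A valley has [i <= size b] and [j <= size b + 1], so the ordinal bounds in [diag_cond] lose
    none. *)
Lemma diag_condP n (b : ballot_path (2 * n)) (w : signed_perm n) :
  diag_cond b w <->
  forall i j, ballot_valley b i j ->
    (if (j <= n)%N then w (n.+1%:Z - j%:Z) < w (n.+1%:Z - i%:Z)
     else w (n%:Z - j%:Z) < w (n.+1%:Z - i%:Z)).
Proof.
split=> [bw i j ij|bw]; last by do 2!apply/forallP => ?; apply/implyP/bw.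
have /ballot_valleyP[w1 [w2 [eb ei ej]]] := ij.
have i_b : (i < (size b).+1)%N.
  have := congr1 size eb; rewrite size_rcons size_cat /= ei !addnS !ltnS => -[->].
  by rewrite ltnS (leq_trans (count_size _ _)) ?leq_addr.
have j_b : (j < (size b).+2)%N.
  have := congr1 size eb; rewrite size_rcons size_cat /= ej !addnS !ltnS => -[->].
  by rewrite (leq_trans (count_size _ _)) // -addnS leq_addr.
by have /forallP/(_ (Ordinal i_b))/forallP/(_ (Ordinal j_b))/implyP/(_ ij) := bw.
Qed.

(** * Equivalence of the two labelling conditions *)

Section DiagVert.
Variables (n : nat) (p : lattice_path n n) (u : signed_perm n).
Local Notation A := (area p).

Lemma dC_order : dC p u = map u (diag_order p).
Proof.
rewrite /dC /diag_order map_flatten -map_comp; congr flatten; apply: eq_map => i /=.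
rewrite map_cat /neg_at /pos_at /negatives /positives -!map_rev -map_comp.
rewrite !filter_map -!map_comp; congr (_ ++ _).
  have -> : [seq j <- rev (iota 1 n) | mu p (n.+1 - j)%N == - i%:Z]
            = [seq j <- rev (iota 1 n) | preim (-%R \o Posz) (fun x => A x == i%:Z) j].
    apply: eq_in_filter => j; rewrite mem_rev mem_iota => jn /=.
    by rewrite areaN /area absz_nat gtr0_sgz ?mul1r ?eqr_oppLR //; lia.
  by apply: eq_map => j /=; rewrite signed_permN.
have -> // : [seq j <- iota 1 n | mu p (n.+1 - j)%N == i%:Z + 1]
          = [seq j <- iota 1 n | preim Posz (fun x => A x == i.+1%:Z) j].
apply: eq_in_filter => j; rewrite mem_iota => jn /=.
by rewrite /area absz_nat gtr0_sgz ?mul1r ?intS 1?addrC //; lia.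
Qed.

Lemma perm_abs_dC : perm_eq (map absz (dC p u)) (iota 1 n).
Proof. by rewrite dC_order; apply/perm_abs_signed_perm/perm_diag_order. Qed.

(** A rise [j] is seen at the pair [(j + 1, j)] if [A j >= 0], and at the opposite pair
    [(-j, -j - 1)] if [A j < 0]. An initial North step is seen at [(1, 0)], where [u 0 = 0]. The
    turn [(-n, n)] never qualifies, since [- A n = A n + 1] has no integer solution. *)
Lemma vert_condP : (0 < n)%N ->
  vert_cond p u <->
  forall x y, infix [:: x; y] (rcons (reading_order n) 0) -> A x = A y + 1 -> 0 <= A y ->
    u y < u x.
Proof.
move=> n0; split=> [/andP[/forallP rise_u head_u] x y|pairs_u].
  have {}rise_u j : (0 < j < n)%N -> A j.+1 = A j + 1 -> u j%:Z < u j.+1%:Z.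
    move=> jn /eqP Aj; have j_p : (j < (size p).+1)%N by rewrite size_path; lia.
    by have := rise_u (Ordinal j_p); rewrite rise_area jn Aj.
  case/(consecutiveP _ _ n0) => [j jn -> ->|-> ->|[|j] jn -> ->].
  - rewrite !areaN !signed_permN => Aj _; rewrite ltrN2; apply: rise_u => //; lia.
  - by rewrite areaN; lia.
  - rewrite signed_perm0 area0 => A1 _; apply: (implyP head_u).
    by rewrite head_area // A1.
  by move=> Aj _; apply: rise_u.
apply/andP; split; last first.
  rewrite head_area //; apply/implyP => /eqP A1; rewrite -(signed_perm0 u).
  apply: pairs_u; rewrite ?area0 //; apply/(consecutiveP _ _ n0).
  exact: (ConsecutivePos (j := 0)).
apply/forallP => -[j j_p] /=; rewrite rise_area; apply/implyP => /andP[jn /eqP Aj].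
have [A0|A0] := lerP 0 (A j).
  apply: pairs_u => //; apply/(consecutiveP _ _ n0).
  by apply: (ConsecutivePos (j := j)) => //; lia.
rewrite -ltrN2 -!signed_permN; apply: pairs_u; rewrite ?areaN; [|lia..].
by apply/(consecutiveP _ _ n0); apply: (ConsecutiveNeg (j := j)).
Qed.

End DiagVert.

Section Labels.
Variables (n : nat) (p : lattice_path n n) (u w : signed_perm n).
Hypothesis w_window : window w = dC p u.
Local Notation e := (diag_order p).
Local Notation Z := (labelled_zeta p).

Lemma diag_perm_nth k : (k < n)%N -> w k.+1%:Z = u (nth 0 e k).
Proof.
move=> kn; rewrite -nth_window // w_window dC_order (nth_map 0) //.
by rewrite size_diag_order.
Qed.

(** A valley of the extended word; [i] and [j] are the numbers of its East and North steps. *)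
Variables (Z1 Z2 : seq (step * int)) (x y : int).
Hypothesis ZE : rcons Z (North, 0) = Z1 ++ [:: (East, x), (North, y) & Z2].
Local Notation i := (size (labels East Z1)).+1.
Local Notation j := (size (labels North Z1)).+1.

Lemma diag_order_split_east :
  e = (neg_at p 0 ++ rev (labels East Z2)) ++ x :: rev (labels East Z1).
Proof.
have := congr1 (labels East) ZE; rewrite -cats1 !labels_cat /= cats0 => eE.
by rewrite diag_order_east eE rev_cat rev_cons cat_rcons catA.
Qed.

Lemma diag_order_split_north :
  0 :: pos_at p 0 ++ e = rev (labels North Z2) ++ y :: rev (labels North Z1).
Proof.
have := congr1 (labels North) ZE; rewrite -cats1 !labels_cat /= cats1 => eN.
by rewrite diag_order_north -(rev_rcons _ 0) [rcons _ _]eN rev_cat rev_cons cat_rcons.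
Qed.

(** By [diag_order_split_east], exactly [i - 1] entries of [diag_order] follow [x], so [x] is its
    entry number [n + 1 - i]. *)
Lemma east_label : w (n.+1%:Z - i%:Z) = u x.
Proof.
have sz := size_diag_order p; have eE := diag_order_split_east.
have szE := congr1 size eE.
rewrite sz size_cat /= size_rev in szE.
have -> : n.+1%:Z - i%:Z = (size (neg_at p 0 ++ rev (labels East Z2))).+1%:Z.
  by rewrite {1}szE -addSn PoszD addrK.
rewrite diag_perm_nth; last by rewrite {2}szE -[X in (X <= _)%N]addn1 leq_add2l.
by rewrite eE nth_cat ltnn subnn.
Qed.

(** If [j <= n], then [y] is entry [n + 1 - j] of [diag_order]. If [j > n] and [y] lies in
    [pos_at 0], then [-y] is entry [j - n], in [neg_at 0], and [w(n - j) = u y] by oddness. If [y]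
    is the appended 0, then [x] is entry [j - n] and [w(n - j) = - u x]; only the comparisons agree,
    as [- u x < u x] means [0 < u x]. *)
Lemma north_label :
  (if (j <= n)%N then w (n.+1%:Z - j%:Z) < u x else w (n%:Z - j%:Z) < u x) = (u y < u x).
Proof.
have sz := size_diag_order p; have eN := diag_order_split_north.
have szN := congr1 size eN.
rewrite /= (size_cat (pos_at p 0)) sz size_cat /= !size_rev in szN.
have [z zE] : {z | z = size (pos_at p 0)} by exists (size (pos_at p 0)).
have [c cE] : {c | c = size (labels North Z1)} by exists (size (labels North Z1)).
have [l2 l2E] : {l | l = size (labels North Z2)} by exists (size (labels North Z2)).
rewrite -zE -cE -l2E in szN; rewrite -cE.
have nthN : nth 0 (0 :: pos_at p 0 ++ e) l2 = y.
  by rewrite eN nth_cat size_rev -l2E ltnn subnn.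
have [jn|jn] := leqP c.+1 n.
  have -> : n.+1%:Z - c.+1%:Z = (n - c.+1).+1%:Z by lia.
  rewrite diag_perm_nth; last by lia.
  have l2z : l2 = (z + (n - c.+1)).+1 by lia.
  by rewrite -nthN l2z /= nth_cat -zE ltnNge leq_addr addKn.
have -> : n%:Z - c.+1%:Z = - (c - n).+1%:Z by lia.
rewrite signed_permN.
have z_size : z = size (neg_at p 0) by rewrite zE pos_at0 size_rev size_map.
have z_n : (z <= n)%N.
  by rewrite -sz diag_order_split_east !size_cat -z_size -addnA leq_addr.
have [l2_0|l2_gt0] := posnP l2; last first.
  rewrite diag_perm_nth; last by lia.
  have l2z : l2 = (z - (c - n).+1).+1 by lia.
  have jz : (c - n < z)%N by lia.
  rewrite -nthN l2z /= nth_cat -zE ltn_subrL (leq_ltn_trans _ jz) //= pos_at0.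
  rewrite nth_rev size_map -z_size ?ltn_subrL ?(leq_ltn_trans _ jz) //.
  rewrite (nth_map 0); last by rewrite -z_size; lia.
  rewrite signed_permN diag_order_split_east -catA nth_cat -z_size jz.
  by congr (- u (nth 0 _ _) < _); lia.
have Z2_nil : Z2 = [::].
  move: l2_0; rewrite l2E; case/lastP: Z2 ZE {l2E eN} => // s d.
  rewrite -!rcons_cons -rcons_cat => /rcons_inj[_ <-] /=.
  by rewrite -cats1 labels_cat size_cat /= addn1.
have y0 : y = 0 by rewrite -nthN l2_0.
have zn : (z < n)%N.
  by rewrite -sz diag_order_split_east !size_cat -z_size /=; lia.
rewrite diag_perm_nth; last by lia.
rewrite (_ : (c - n)%N = z); last by lia.
rewrite diag_order_split_east Z2_nil cats0 nth_cat -z_size ltnn subnn /= y0 signed_perm0.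
by move: (u x) => v; lia.
Qed.

End Labels.

Lemma map_cat_split (S T : Type) (f : S -> T) (z : seq S) (a b : T) w1 w2 :
  map f z = w1 ++ [:: a, b & w2] ->
  exists z1 c d z2, [/\ z = z1 ++ [:: c, d & z2], map f z1 = w1, f c = a & f d = b].
Proof.
elim: w1 z => [|a1 w1 IH] [|c z] //=.
  by case: z => [|d z] //= [ca db _]; exists [::], c, d, z.
by case=> ca1 /IH[z1 [c' [d [z2 [-> z1w <- <-]]]]]; exists (c :: z1), c', d, z2; rewrite /= ca1 z1w.
Qed.

(** Both conditions say that [u y < u x] for each pair East at [x], North at [y] in the extended
    labelled word. *)
Lemma diag_cond_vert_cond n (p : lattice_path n n) (b : ballot_path (2 * n))
    (u w : signed_perm n) :
  (0 < n)%N -> (b : seq step) = zetaC p -> window w = dC p u ->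
  diag_cond b w = vert_cond p u.
Proof.
move=> n0 bE w_window.
have eZ : map fst (rcons (labelled_zeta p) (North, 0)) = rcons b North.
  by rewrite map_rcons -zetaC_labelled bE.
have pairs : vert_cond p u <-> forall x y,
    infix [:: (East, x); (North, y)] (rcons (labelled_zeta p) (North, 0)) -> u y < u x.
  rewrite vert_condP //; split=> pairs x y; last first.
    by move=> xy /eqP Ax Ay; apply: pairs; rewrite labelled_zeta_infix // xy Ax.
  by rewrite labelled_zeta_infix // => /and3P[xy /eqP Ax Ay]; apply: pairs.
apply/idP/idP => [/diag_condP bw|/pairs up].
  apply/pairs => x y /infixP[Z1 [Z2 /= ZE]]; rewrite -(north_label w_window ZE).
  rewrite -(east_label w_window ZE); apply: bw; apply/ballot_valleyP.
  by exists (map fst Z1), (map fst Z2); rewrite -eZ ZE map_cat !size_labels.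
apply/diag_condP => i j /ballot_valleyP[w1 [w2 [bN -> ->]]].
have [] := map_cat_split (etrans eZ bN).
move=> Z1 [[d x] [[d' y] [Z2 [ZE <- /= ed ed']]]]; rewrite {d}ed {d'}ed' in ZE.
rewrite -!size_labels (east_label w_window ZE) (north_label w_window ZE); apply: up.
by apply/infixP; exists Z1, Z2.
Qed.

(** * Counting ballot paths by reflection *)

Fixpoint words (m : nat) : seq (seq step) :=
  if m is m'.+1 then map (cons North) (words m') ++ map (cons East) (words m')
  else [:: [::]].

Lemma mem_words m w : (w \in words m) = (size w == m).
Proof.
have cons_inj (d : step) : injective (cons d) by move=> ? ? [].
elim: m w => [|m IH] w /=; first by rewrite inE; case: w.
rewrite mem_cat; case: w => [|d w]; first by apply/negbTE/negP => /orP[]/mapP[].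
apply/orP/idP => [[]/mapP[v]|/=]; rewrite ?IH.
- by move=> /eqP<- [_ ->].
- by move=> /eqP<- [_ ->].
by case: d => wm; [left|right]; rewrite mem_map // IH.
Qed.

Lemma uniq_words m : uniq (words m).
Proof.
have cons_inj (d : step) : injective (cons d) by move=> ? ? [].
elim: m => //= m IH; rewrite cat_uniq !map_inj_uniq // IH andbT /=.
by apply/hasPn => _ /mapP[w _ ->]; apply/negP => /mapP[].
Qed.

Lemma card_words m (P : pred (seq step)) :
  #|[pred w : m.-tuple step | P w]| = count P (words m).
Proof.
have perm_w : perm_eq (map val (enum {: m.-tuple step})) (words m).
  apply: uniq_perm; rewrite ?uniq_words ?(map_inj_uniq val_inj) ?enum_uniq // => w.
  rewrite mem_words; apply/mapP/idP => [[v _ ->]|wm]; first by rewrite size_tuple.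
  by exists (Tuple wm); rewrite ?mem_enum.
by rewrite -(seq.permP perm_w) count_map cardE size_filter enumT.
Qed.

Definition height (w : seq step) : int := (count_mem North w)%:Z - (count_mem East w)%:Z.

(** The starting height [h] varies so that counting can proceed by induction on the first step. *)
Fixpoint stays_above (h : nat) (w : seq step) : bool :=
  match w with
  | [::] => true
  | North :: w' => stays_above h.+1 w'
  | East :: w' => if h is h'.+1 then stays_above h' w' else false
  end.

Lemma stays_aboveP h (w : seq step) :
  reflect (forall k, (count_mem East (take k w) <= h + count_mem North (take k w))%N)
          (stays_above h w).
Proof.
elim: w h => [|[] w IH] h /=; first by left=> -[].
  apply: (iffP (IH _)) => hw k; last by have := hw k.+1 => /=; lia.
  by case: k => [|k] //=; have := hw k; rewrite add1n addnS.
case: h => [|h]; first by right=> /(_ 1%N); rewrite /= take0.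
apply: (iffP (IH _)) => hw k; last by have := hw k.+1 => /=; lia.
by case: k => [|k] //=; have := hw k; rewrite add1n addSn ltnS.
Qed.

Lemma ballot_wordE w : ballot_word w = stays_above 0 w.
Proof.
apply/forallP/stays_aboveP => bw k; last exact: bw.
have [kw|kw] := ltnP k (size w).+1; first exact: (bw (Ordinal kw)).
by rewrite take_oversize ?(ltnW kw) //; have := bw ord_max; rewrite /= take_size.
Qed.

(* The reflection principle: the words of height at least -h that do go below
   -h are equinumerous with the words of height at least h + 2. *)
Lemma count_stays_above m (h : nat) :
  (count (stays_above h) (words m) + count (fun w => (h%:Z + 2 <= height w)%R) (words m)
   = count (fun w => (- h%:Z <= height w)%R) (words m))%N.
Proof.
elim: m h => [|m IH] h; first by rewrite /height /=; lia.
have step (d : int) : count (fun w => d <= height w) (words m.+1)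
    = (count (fun w => (d - 1 <= height w)%R) (words m)
       + count (fun w => (d + 1 <= height w)%R) (words m))%N.
  rewrite /= count_cat !count_map; congr (_ + _)%N; apply: eq_count => w.
    by rewrite /height /=; lia.
  by rewrite /height /=; lia.
rewrite !step /= count_cat !count_map.
rewrite (eq_count (a1 := preim (cons North) _) (a2 := stays_above h.+1)) //.
have := IH h.+1; rewrite (_ : h.+1%:Z + 2 = h%:Z + 2 + 1); last by lia.
rewrite (_ : - h.+1%:Z = - h%:Z - 1); last by lia.
case: h => [|h].
  rewrite (eq_count (a1 := preim (cons East) _) (a2 := pred0)) // count_pred0.
  by rewrite addn0 => <-; rewrite addnAC addnA.
rewrite (eq_count (a1 := preim (cons East) _) (a2 := stays_above h)) //.
have := IH h; rewrite (_ : h%:Z + 2 = h.+1%:Z + 2 - 1); last by lia.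
rewrite (_ : - h%:Z = - h.+1%:Z + 1); last by lia.
by move=> <- <-; lia.
Qed.

(** By [count_stays_above] at [h = 0], ballot words number as many as words of height at least 0 but
    less than 2. In even length that height is 0, which describes the words of lattice paths. *)
Lemma card_ballot_path n : #|{: ballot_path (2 * n)}| = #|{: lattice_path n n}|.
Proof.
have -> : #|{: ballot_path (2 * n)}| = count (stays_above 0) (words (2 * n)).
  rewrite card_sub -card_words; apply: eq_card => w; exact: ballot_wordE.
have -> : #|{: lattice_path n n}|
          = count (fun w => (count_mem East w == n) && (count_mem North w == n)) (words (n + n)).
  by rewrite card_sub -card_words; apply: eq_card.
apply/eqP; rewrite -(eqn_add2r (count (fun w => (0%:Z + 2 <= height w)%R) (words (2 * n)))).
rewrite count_stays_above mul2n -addnn -count_predUI.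
rewrite [count (predI _ _) _](eq_count (a2 := pred0)) ?count_pred0 ?addn0.
  apply/eqP/eq_in_count => w; rewrite mem_words size_steps /height /=; lia.
by move=> w; rewrite /height /=; lia.
Qed.

(** * Bijectivity on paths, on labels, and on pairs *)

Definition zetaC_path n (p : lattice_path n n) : ballot_path (2 * n) :=
  Sub (Tuple (introT eqP (size_zetaC p))) (zetaC_ballot p).

Lemma zetaC_path_bij n : (0 < n)%N -> bijective (@zetaC_path n).
Proof.
move=> n0; apply: inj_card_bij; last by rewrite card_ballot_path.
by move=> p q /(congr1 (fun b : ballot_path _ => b : seq step)) /(zetaC_inj n0).
Qed.

Lemma dC_inj n (p : lattice_path n n) : injective (dC p).
Proof.
move=> u v; rewrite !dC_order => /eq_in_map uv; apply: window_inj.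
apply/eq_in_map => k; rewrite mem_iota => kn.
have : k \in map absz (diag_order p) by rewrite (perm_mem (perm_diag_order p)) mem_iota.
case/mapP=> x /uv; case: x => [j|j] /= uvx ->; first exact: uvx.
by move: uvx; rewrite NegzE !signed_permN => /oppr_inj.
Qed.

(** Through windows, [dC p] becomes an injective self-map of the finite set of signed permutations,
    hence a bijection. *)
Lemma dC_surj n (p : lattice_path n n) (w : signed_perm n) :
  exists u, dC p u = window w.
Proof.
have [f fP] : exists f : signed_perm n -> signed_perm n, forall u, window (f u) = dC p u.
  apply: (@fin_all_exists _ _ (fun u w' => window w' = dC p u)) => u.
  exact/window_surj/perm_abs_dC.
have /injF_bij[g _ fK] : injective f.
  by move=> u v uv; apply: (@dC_inj _ p); rewrite -!fP uv.
by exists (g w); rewrite -fP fK.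
Qed.

Theorem theorem4p18 (n : nat) (hn : (1 <= n)%N) :
  exists zeta : Vert n -> Diag n,
    (forall x : Vert n,
        (diag_path (zeta x) : seq step) = zetaC (vert_path x)
        /\ window (diag_perm (zeta x)) = dC (vert_path x) (vert_perm x))
    /\ bijective zeta.
Proof.
have zeta_ex (x : Vert n) : exists y : Diag n,
    (diag_path y : seq step) = zetaC (vert_path x)
    /\ window (diag_perm y) = dC (vert_path x) (vert_perm x).
  have [w wE] := window_surj (perm_abs_dC (vert_path x) (vert_perm x)).
  have bw : diag_cond (zetaC_path (vert_path x)) w.
    by rewrite (diag_cond_vert_cond hn _ wE) //; apply: (valP x).
  by exists (Sub (zetaC_path (vert_path x), w) bw); rewrite /diag_path /diag_perm SubK.
have [zeta zetaP] := fin_all_exists zeta_ex; exists zeta; split=> //.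
have [path_of path_ofK zetaCK] := zetaC_path_bij hn.
have zeta_inj : injective zeta.
  move=> x y xy; have [px wx] := zetaP x; have [py wy] := zetaP y.
  have pxy : vert_path x = vert_path y by apply: (zetaC_inj hn); rewrite -px -py xy.
  have uxy : vert_perm x = vert_perm y.
    by apply: (@dC_inj _ (vert_path x)); rewrite -wx xy wy pxy.
  by apply: val_inj; rewrite [val x]surjective_pairing [val y]surjective_pairing; congr (_, _).
(* The path is recovered first, then [u] by inverting [dC] for that path; [diag_cond_vert_cond]
   places the pair in [Vert n]. *)
have zeta_surj y : exists x, zeta x = y.
  have [u uE] := dC_surj (path_of (diag_path y)) (diag_perm y).
  have bE : (diag_path y : seq step) = zetaC (path_of (diag_path y)).
    by rewrite -{1}(zetaCK (diag_path y)).
  have vu : vert_cond (path_of (diag_path y)) u.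
    by rewrite -(diag_cond_vert_cond hn bE (esym uE)); apply: (valP y).
  pose x : Vert n := Sub (path_of (diag_path y), u) vu; exists x.
  have [px wx] := zetaP x; apply: val_inj.
  rewrite [val (zeta x)]surjective_pairing [val y]surjective_pairing; congr (_, _).
    by do 2!apply: val_inj; apply: (etrans px (esym bE)).
  by apply: window_inj; apply: (etrans wx uE).
have [inv invK] := fin_all_exists zeta_surj.
by exists inv => // x; apply: zeta_inj.
Qed.
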